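(* Let $M=(X,d_X)$ and $M'=(Y,d_Y)$ be metric spaces with $\eta(M)>0$. The lexicographic metric space $M\circ M'$ is complete if and only if $M'$ is complete.
   Context: All metric spaces are nonempty. For a metric space $M=(X,d_X)$ and $x\in X$, the nearness of $x$ is $\eta(x)=\inf\{d_X(x,y): y\in X\setminus\{x\}\}$ and the nearness of $M$ is $\eta(M)=\inf\{\eta(x): x\in X\}$ (with $\inf\emptyset=+\infty$). If $M=(X,d_X)$ and $M'=(Y,d_Y)$ are metric spaces with $\eta(M)>0$, the lexicographic metric space is $M\circ M'=(X\times Y,\rho)$, where $\rho((x,y),(x',y'))=d_X(x,x')$ if $x\neq x'$, and $\rho((x,y),(x',y'))=\min\{2\eta(x),d_Y(y,y')\}$ if $x=x'$; $\rho$ is a metric. *)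

(* Defs.v *)
From HB Require Import structures.
From mathcomp Require Import all_boot all_order all_algebra.
From mathcomp Require Import all_classical all_reals all_analysis.
From mathcomp Require Import lra.

Set Implicit Arguments.
Unset Strict Implicit.
Unset Printing Implicit Defensive.

Import Order.TTheory GRing.Theory Num.Theory.
Import numFieldNormedType.Exports.

Local Open Scope classical_set_scope.
Local Open Scope ring_scope.

Section nearness.
Context {R : realType} (M : metricType R).

(* The value is +oo when x is the only point of M. *)
Definition nearness_at (x : M) : \bar R :=
  ereal_inf [set (mdist x y)%:E | y in ~` [set x]].

Definition nearness : \bar R := ereal_inf (range nearness_at).

Lemma nearness_at_le (x y : M) : x != y -> (nearness_at x <= (mdist x y)%:E)%E.
Proof.
move=> xy; apply: ereal_inf_lbound; exists y => //= yx.
by rewrite yx eqxx in xy.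
Qed.

Lemma nearness_le (x : M) : (nearness <= nearness_at x)%E.
Proof. by apply: ereal_inf_lbound; exists x. Qed.

End nearness.

Section lexdist.
Context {R : realType} (M N : metricType R).

(* [fine] is harmless: the minimum is bounded above by a finite distance and
   below by 0. *)
Definition lexdist (p q : M * N) : R :=
  if p.1 == q.1 then
    fine (Order.min (2%:E * nearness_at p.1)%E (mdist p.2 q.2)%:E)
  else mdist p.1 q.1.

Hypothesis M_gt0 : (0 < nearness M)%E.

Lemma nearness_at_gt0 (x : M) : (0 < nearness_at x)%E.
Proof. exact: lt_le_trans M_gt0 (nearness_le x). Qed.

Lemma nearness_atP (x : M) :
  (forall y, x = y) /\ nearness_at x = +oo%E \/
  exists2 r, 0 < r & nearness_at x = r%:E.
Proof.
have := nearness_at_gt0 x; case E : (nearness_at x) => [r| |] //= r0.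
  by right; exists r.
left; split=> // y; apply/eqP/negPn/negP => /nearness_at_le.
by rewrite E.
Qed.

Lemma lexdist_oo (p q : M * N) : p.1 = q.1 -> nearness_at p.1 = +oo%E ->
  lexdist p q = mdist p.2 q.2.
Proof.
by rewrite /lexdist => <- ->; rewrite eqxx mulry gtr0_sg// mul1e minye.
Qed.

Lemma lexdist_fin r (p q : M * N) : p.1 = q.1 -> nearness_at p.1 = r%:E ->
  lexdist p q = Num.min (2 * r) (mdist p.2 q.2).
Proof. by rewrite /lexdist => <- ->; rewrite eqxx -EFinM -EFin_min. Qed.

Lemma lexdistxx (p : M * N) : lexdist p p = 0.
Proof.
have [[_ E]|[r r0 E]] := nearness_atP p.1.
  by rewrite (lexdist_oo _ E)// mdistxx.
by rewrite (lexdist_fin _ E)// mdistxx min_r// mulr_ge0// ltW.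
Qed.

Lemma lexdist_positivity (p q : M * N) : lexdist p q = 0 -> p = q.
Proof.
case: (eqVneq p.1 q.1) => pq; last first.
  by rewrite /lexdist (negbTE pq) => /mdist_positivity /eqP; rewrite (negbTE pq).
move=> h; suff: p.2 = q.2.
  by case: p q pq {h} => [? ?] [? ?] /= -> ->.
apply: mdist_positivity; move: h.
have [[_ E]|[r r0 E]] := nearness_atP p.1; first by rewrite (lexdist_oo _ E).
rewrite (lexdist_fin _ E)//; case: (lerP (2 * r)) => // _ /eqP.
by rewrite mulf_eq0 pnatr_eq0/= gt_eqF.
Qed.

Lemma lexdist_sym (p q : M * N) : lexdist p q = lexdist q p.
Proof.
rewrite /lexdist eq_sym; case: eqP => [->|_]; last exact: metric_sym.
by rewrite (metric_sym p.2).
Qed.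

Lemma lexdist_ge0 (p q : M * N) : 0 <= lexdist p q.
Proof.
case: (eqVneq p.1 q.1) => pq; last by rewrite /lexdist (negbTE pq) mdist_ge0.
have [[_ E]|[r r0 E]] := nearness_atP p.1.
  by rewrite (lexdist_oo _ E)// mdist_ge0.
by rewrite (lexdist_fin _ E)// le_min mdist_ge0 mulr_ge0// ltW.
Qed.

Lemma lexdist_triangle (q p s : M * N) :
  lexdist p s <= lexdist p q + lexdist q s.
Proof.
have pq0 := lexdist_ge0 p q; have qs0 := lexdist_ge0 q s.
case: (eqVneq p.1 q.1) => pq; case: (eqVneq q.1 s.1) => qs.
- have T := metric_triangle p.2 q.2 s.2.
  have := mdist_ge0 p.2 q.2; have := mdist_ge0 q.2 s.2.
  have [[_ E]|[r r0 E]] := nearness_atP p.1.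
    by rewrite !lexdist_oo// -?pq// pq.
  rewrite !(@lexdist_fin r)// -?pq// ?pq// => a0 b0.
  case: (lerP _ (mdist p.2 s.2)) => ?; case: (lerP _ (mdist p.2 q.2)) => ?;
    by case: (lerP _ (mdist q.2 s.2)) => ?; lra.
- have ps : p.1 != s.1 by rewrite pq.
  by rewrite /(lexdist p s) /(lexdist q s) (negbTE ps) (negbTE qs) -pq lerDr.
- have ps : p.1 != s.1 by rewrite -qs.
  by rewrite /(lexdist p s) /(lexdist p q) (negbTE ps) (negbTE pq) qs lerDl.
rewrite /(lexdist p q) /(lexdist q s) (negbTE pq) (negbTE qs).
case: (eqVneq p.1 s.1) => ps; last first.
  by rewrite /lexdist (negbTE ps) metric_triangle.
have := nearness_at_le pq; rewrite -ps (metric_sym q.1).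
have [[/(_ q.1) pq1 _]|[r r0 E]] := nearness_atP p.1.
  by rewrite pq1 eqxx in pq.
by rewrite (lexdist_fin _ E)// E lee_fin => rle; case: (lerP _ (mdist p.2 s.2)) => ?; lra.
Qed.

End lexdist.

(* The hypothesis is a parameter of the type: without it [lexdist] may vanish on
   distinct points.  The alias keeps the canonical product uniform structure of
   [M * N] out of the way. *)
Definition lexprod {R : realType} (M N : metricType R)
  (M_gt0 : (0 < nearness M)%E) : Type := (M * N)%type.

HB.instance Definition _ {R : realType} (M N : metricType R)
    (M_gt0 : (0 < nearness M)%E) :=
  Choice.copy (lexprod N M_gt0) (M * N)%type.

HB.instance Definition _ {R : realType} (M N : metricType R)
    (M_gt0 : (0 < nearness M)%E) :=
  isMetric.Build R (lexprod N M_gt0) (lexdistxx M_gt0)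
    (lexdist_positivity M_gt0) (@lexdist_sym R M N) (lexdist_triangle M_gt0).

Lemma mdist_lexprodE {R : realType} (M N : metricType R)
    (M_gt0 : (0 < nearness M)%E) (p q : lexprod N M_gt0) :
  mdist p q = lexdist p q.
Proof. by []. Qed.

Definition complete_metric {R : realType} (T : metricType R) : Prop :=
  forall u : nat -> T, cauchy (u @ \oo) -> exists l : T, u @ \oo --> l.

(* Completeness of a [completeType] is phrased with filters and requires a
   pointed type; on metric spaces the two notions agree. *)
Lemma complete_metricP {R : realType} (T : metricType R) :
  complete_metric T <->
  (forall F : set_system T, ProperFilter F -> cauchy F -> exists l : T, F --> l).
Proof.
split=> [cT F FF /cauchyP Fc|cT u uc]; last exact: cT.
have /choice[u uF] : forall n : nat, exists x, F (ball x (n.+1%:R^-1 : R)).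
  by move=> n; apply: Fc.
have ud n m : mdist (u n) (u m) < n.+1%:R^-1 + m.+1%:R^-1.
  have [z [nz mz]] := filter_ex (filterI (uF n) (uF m)).
  have := ball_triangle nz (ball_sym mz).
  by rewrite ballEmdist.
have [|l ul] := cT u.
  apply/cauchy_ballP => e e0; rewrite near_map2.
  have e20 : 0 < e / 2 by rewrite divr_gt0.
  have := near_infty_natSinv_lt (PosNum e20) => /= ne.
  near=> n m => /=; rewrite ballEmdist/= (lt_trans (ud _ _))// (splitr e) ltrD//.
    by near: n.
  by near: m.
exists l; apply/cvg_ballP => e e0.
have e20 : 0 < e / 2 by rewrite divr_gt0.
have ne := near_infty_natSinv_lt (PosNum e20).
have [n [/= /ltW ne2 lu]] := filter_ex (filterI ne (cvg_ball ul e20)).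
apply: filterS (uF n) => y /(le_ball ne2) uy.
by rewrite (splitr e); exact: ball_triangle lu uy.
Unshelve. all: by end_near. Qed.

(* Main.v *)
Require Import Defs.
From mathcomp Require Import all_boot all_order all_algebra.
From mathcomp Require Import all_classical all_reals all_analysis.
From mathcomp Require Import lra.

(** Since the nearness of [M] is positive, all points of [M] are separated by a
    uniform distance [c > 0]. A lexicographic distance smaller than [c] can
    therefore only occur inside a single fibre [{x} * M'], and there it is the
    distance of [M'], because the truncation at [2 eta(x) >= 2c] is not felt
    ([ball_lexprodE]). So, uniformly at small scale, [M o M'] is a disjoint
    union of copies of [M'] indexed by the points of [M].

    Cauchy sequences and limits depend on small balls only. Hence a sequence is
    Cauchy in [M o M'] exactly when its first coordinate is eventually constant
    and its second coordinate is Cauchy ([cauchy_lexprodP]), and it converges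
    exactly when its first coordinate is eventually that of the limit and its
    second coordinate converges ([cvg_lexprodP]). A Cauchy sequence of [M o M']
    thus eventually lives in one copy of [M'], where completeness of [M']
    provides a limit; conversely a Cauchy sequence of [M'] is placed in the
    copy above any chosen point of [M]. *)

Set Implicit Arguments.
Unset Strict Implicit.
Unset Printing Implicit Defensive.

Import Order.TTheory GRing.Theory Num.Theory.
Import numFieldNormedType.Exports.

Local Open Scope classical_set_scope.
Local Open Scope ring_scope.

(** The nearness itself serves as [c], except when it is infinite, that is, when
    [M] has at most one point; any positive real then does. *)
Lemma nearness_lower_bound (R : realType) (M : metricType R) :
  (0 < nearness M)%E ->
  exists2 c : R, 0 < c & forall x : M, (c%:E <= nearness_at x)%E.
Proof.
case E : (nearness M) => [r| |] //= r0.
  by exists r => // x; rewrite -E nearness_le.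
by exists 1 => // x; rewrite (le_trans _ (nearness_le x))// E leey.
Qed.

Section small_scale.
Context {R : realType} (M N : metricType R) (M_gt0 : (0 < nearness M)%E).
Variable c : R.
Hypotheses (c_gt0 : 0 < c) (c_le : forall x : M, (c%:E <= nearness_at x)%E).

Local Notation L := (lexprod N M_gt0).

(** Leaving the fibre of [p] costs at least [eta(p.1) >= c], and within it the
    truncation level [2 eta(p.1)] exceeds [c]; so a radius at most [c] sees only
    the metric of [N]. *)
Lemma ball_lexprodE (e : R) (p q : L) : e <= c ->
  ball p e q <-> p.1 = q.1 /\ ball p.2 e q.2.
Proof.
move=> ec; rewrite !ballEmdist/= mdist_lexprodE.
have [pq|pq] := eqVneq p.1 q.1; last first.
  rewrite /lexdist (negbTE pq); split=> [pqe|[/eqP]]; last by rewrite (negbTE pq).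
  have := le_trans (c_le p.1) (nearness_at_le pq).
  by rewrite lee_fin leNgt (lt_le_trans pqe ec).
have [[_ E]|[r r0 E]] := nearness_atP M_gt0 p.1.
  by rewrite (lexdist_oo pq E); split=> [|[]].
have := c_le p.1; rewrite E lee_fin => cr.
rewrite (lexdist_fin pq E) gt_min.
have -> : (2 * r < e) = false by apply/negbTE; rewrite -leNgt; lra.
by split=> [|[]].
Qed.

(** The radius [c] makes the first coordinate stationary. For the second one,
    [Num.min e c] replaces an arbitrary radius [e], which loses nothing because
    the condition is monotone in the radius. *)
Lemma cauchy_lexprodP (u : nat -> L) :
  cauchy (u @ \oo) <->
  (exists x, \forall n \near \oo, (u n).1 = x) /\
  cauchy ((fun n => (u n).2) @ \oo).
Proof.
split=> [/cauchy_ballP uc|[[x ux] /cauchy_ballP uc]].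
- split.
    have := uc c c_gt0; rewrite near_map2 => -[[A B] /= [Aoo Boo] AB].
    (* Any index of the first tail fixes the fibre of the whole second tail. *)
    have [m Am] := filter_ex Aoo; exists (u m).1.
    apply: filterS Boo => n Bn; have := AB (m, n) (conj Am Bn).
    by case/(ball_lexprodE _ _ (lexx c)).
  apply/cauchy_ballP => e e0; rewrite near_map2.
  have m0 : 0 < Num.min e c by rewrite lt_min e0.
  have := uc _ m0; rewrite near_map2; apply: filterS => -[m n] /=.
  have mc : Num.min e c <= c by rewrite ge_min lexx orbT.
  move=> /(ball_lexprodE _ _ mc)[_]; apply: le_ball.
  by rewrite ge_min lexx.
- apply/cauchy_ballP => e e0; rewrite near_map2.
  have m0 : 0 < Num.min e c by rewrite lt_min e0.
  have := uc _ m0; rewrite near_map2 => uc'.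
  have ux2 : \forall m & n \near \oo, (u m).1 = x /\ (u n).1 = x.
    by exists ([set n | (u n).1 = x], [set n | (u n).1 = x]).
  apply: filterS2 ux2 uc' => -[m n] /= [umx unx] umn.
  have mc : Num.min e c <= c by rewrite ge_min lexx orbT.
  have me : Num.min e c <= e by rewrite ge_min lexx.
  by apply: (le_ball me); apply/(ball_lexprodE _ _ mc); rewrite umx unx.
Qed.

(** The fibre of the limit is open, being the union of the balls of radius [c]
    centred in it; a convergent sequence ends up there, and there its
    convergence is that of [N]. *)
Lemma cvg_lexprodP (u : nat -> L) (l : L) :
  u @ \oo --> l <->
  (\forall n \near \oo, (u n).1 = l.1) /\ (fun n => (u n).2) @ \oo --> l.2.
Proof.
split=> [/cvg_ballP ul|[ul1 /cvg_ballP ul2]].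
- split.
    by apply: filterS (ul c c_gt0) => n /(ball_lexprodE _ _ (lexx c))[].
  apply/cvg_ballP => e e0.
  have m0 : 0 < Num.min e c by rewrite lt_min e0.
  have mc : Num.min e c <= c by rewrite ge_min lexx orbT.
  apply: filterS (ul _ m0) => n /(ball_lexprodE _ _ mc)[_].
  by apply: le_ball; rewrite ge_min lexx.
- apply/cvg_ballP => e e0.
  have m0 : 0 < Num.min e c by rewrite lt_min e0.
  have mc : Num.min e c <= c by rewrite ge_min lexx orbT.
  have me : Num.min e c <= e by rewrite ge_min lexx.
  apply: filterS2 ul1 (ul2 _ m0) => n unl uln.
  by apply: (le_ball me); apply/(ball_lexprodE _ _ mc).
Qed.

End small_scale.

Theorem theorem5 (R : realType) (M M' : metricType R)
    (M_neq0 : [set: M] !=set0) (M'_neq0 : [set: M'] !=set0)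
    (M_gt0 : (0 < nearness M)%E) :
  complete_metric (lexprod M' M_gt0) <-> complete_metric M'.
Proof.
have [c c0 cle] := nearness_lower_bound M_gt0.
split=> [cL v vc|cM' u /(cauchy_lexprodP c0 cle)[[x ux] /cM'[y uy]]].
  have [x _] := M_neq0.
  have [|l] := cL (fun n => (x, v n) : lexprod M' M_gt0).
    apply/(cauchy_lexprodP c0 cle); split=> //.
    by exists x; exact: nearW.
  by move=> /(cvg_lexprodP c0 cle)[_ vl]; exists l.2.
by exists ((x, y) : lexprod M' M_gt0); apply/(cvg_lexprodP c0 cle).
Qed.
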